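(* Let $X_\phi$ be a substitution tiling system in $\mathbb{R}^m$. For any tilings $x,\tilde x\in X_\phi$ and tile types $j$ and $k$, the group $\mathcal{O}_j(x)$ is c-equivalent to $\mathcal{O}_k(\tilde x)$.
   Context: $G_E$ is the connected Euclidean group of $\mathbb{R}^m$, the semidirect product of $SO(m)$ with $\mathbb{R}^m$; $g=(r,t)$ denotes the rotation $r$ about the origin followed by translation by $t$, and $T^g$ denotes its action on tiles, patches and tilings. Substitution tiling systems. $\mathcal{A}$ (the alphabet) is a nonempty finite collection of polyhedra in $\mathbb{R}^m$ (polygons if $m=2$), distinct elements not being congruent under $G_E$. A tile is a copy $T^g b$ ($g\in G_E$) of some $b\in\mathcal{A}$; $b$ is its type. $X(\mathcal{A})$ is the set of all tilings of $\mathbb{R}^m$ by tiles. Congruent means congruent under $G_E$. A patch is a (finite or infinite) subset of a tiling in $X(\mathcal{A})$; $W$ is the set of all patches. A substitution function is a map $\phi:W\to W$ which acts simultaneously on all tiles of a patch by subdividing and stretching about the origin (so $\phi P=\bigcup_{a\in P}\phi a$), such that: (i) there is a constant $|\phi|>1$ such that $\phi(T^g x)=T^{\phi(g)}(\phi x)$ for all $g\in G_E$ and patches $x$, where $\phi(g)$ is the conjugate of $g$ by the similarity stretching about the origin by $|\phi|$ (so $\phi((r,t))=(r,|\phi|t)$); (ii) for each tile $a\in\mathcal{A}$ and $n\ge1$, the union of the tiles in $\phi^n a$ is congruent to $|\phi|^n a$, and these tiles meet full face to full face; (iii) for each $a\in\mathcal{A}$, $\phi a$ contains at least one tile of each type.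 The substitution tiling system $X_\phi\subset X(\mathcal{A})$ is the set of tilings $x$ such that every finite subpatch of $x$ is congruent to a subpatch of $\phi^n a$ for some $n>0$ and $a\in\mathcal{A}$. Two tiles of the same type are parallel if one is a translate of the other. For a tiling $x$ and tile $a\in x$ of type $j$, $R_j(a,x)\subset SO(m)$ is the set of rotations bringing some tile of type $j$ in $x$ parallel to $a$; the group it generates does not depend on the choice of $a$ and is denoted $\mathcal{O}_j(x)$. Two subgroups of $SO(m)$ are c-equivalent if each is conjugate (in $SO(m)$) to a subgroup of the other. *)

(* Defs.v *)
From HB Require Import structures.
From mathcomp Require Import all_boot all_order all_algebra.
From mathcomp Require Import all_classical all_reals all_analysis.

Set Implicit Arguments.
Unset Strict Implicit.
Unset Printing Implicit Defensive.

Import Order.TTheory GRing.Theory Num.Theory.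
Import numFieldNormedType.Exports.

Local Open Scope classical_set_scope.
Local Open Scope ring_scope.

Section RotationsAndMotions.
Context {R : realType} {m : nat}.

Definition SO : set 'M[R]_m := [set r | r *m r^T = 1%:M /\ \det r = 1].

Definition subgroupSO (H : set 'M[R]_m) : Prop :=
  [/\ H `<=` SO, H 1%:M, forall r s, H r -> H s -> H (r *m s)
    & forall r, H r -> H (invmx r)].

Definition genSO (S : set 'M[R]_m) : set 'M[R]_m := smallest subgroupSO S.

Definition conjSO (s : 'M[R]_m) (H : set 'M[R]_m) : set 'M[R]_m :=
  [set s *m r *m invmx s | r in H].

Definition conj_to_subgroup (H K : set 'M[R]_m) : Prop :=
  exists s, SO s /\ exists L, [/\ subgroupSO L, L `<=` K & conjSO s H = L].

Definition c_equivalent (H K : set 'M[R]_m) : Prop :=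
  conj_to_subgroup H K /\ conj_to_subgroup K H.

(* Points of R^m are column vectors. The pair (r, t) stands for the rotation r
   about the origin followed by the translation by t. *)
Definition GE : set ('M[R]_m * 'cV[R]_m) := [set g | SO g.1].

Definition motion (g : 'M[R]_m * 'cV[R]_m) (v : 'cV[R]_m) : 'cV[R]_m :=
  g.1 *m v + g.2.

(* The conjugate of (r, t) by the stretching v |-> l *: v, for l != 0. *)
Definition stretch_conj (l : R) (g : 'M[R]_m * 'cV[R]_m) :=
  (g.1, l *: g.2).

End RotationsAndMotions.

Section Polyhedra.
Context {R : realType} {m : nat}.

Definition conv_polytope (S : set 'cV[R]_m) : Prop :=
  exists n (p : 'I_n -> 'cV[R]_m),
    S = [set v | exists w : 'I_n -> R,
      [/\ forall i, 0 <= w i, \sum_i w i = 1 & v = \sum_i w i *: p i]].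

Definition hyperplane (H : set 'cV[R]_m) : Prop :=
  exists (n : 'rV[R]_m) (c : R), n != 0 /\ H = [set v | (n *m v) 0 0 = c].

Definition relint (E S : set 'cV[R]_m) : set 'cV[R]_m :=
  [set p | E p /\ within E (nbhs p) S].

(* S is a nonempty finite union of convex polytopes lying in E and having
   nonempty interior relative to E; S need be neither convex nor connected. *)
Definition polyhedral_in (E S : set 'cV[R]_m) : Prop :=
  exists n (Q : 'I_n.+1 -> set 'cV[R]_m),
    (forall i, [/\ conv_polytope (Q i), Q i `<=` E & relint E (Q i) !=set0])
    /\ S = \bigcup_i Q i.

(* The sets F and F' have an intersection of dimension m - 1. *)
Definition overlap (F F' : set 'cV[R]_m) : Prop :=
  exists2 H, hyperplane H & relint H (F `&` F') !=set0.

(* A polyhedron comes with its faces of dimension m - 1 (edges if m = 2). As is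
   customary for tilings, distinct faces may lie in the same hyperplane: for
   instance, a side of a polygon may be divided into several edges by vertices
   with a straight angle. *)
Record cell := Cell { body : set 'cV[R]_m; faces : set (set 'cV[R]_m) }.

HB.instance Definition _ := gen_eqMixin cell.
HB.instance Definition _ := gen_choiceMixin cell.

Record polyhedron (a : cell) : Prop := {
  polyhedron_body : polyhedral_in setT (body a);
  polyhedron_finite : finite_set (faces a);
  polyhedron_face : forall F, faces a F ->
    exists2 H, hyperplane H & polyhedral_in H F;
  polyhedron_boundary :
    \bigcup_(F in faces a) F = closure (body a) `\` interior (body a);
  polyhedron_nonoverlap : forall F F', faces a F -> faces a F' ->
    overlap F F' -> F = F' }.

Definition move (g : 'M[R]_m * 'cV[R]_m) (a : cell) : cell :=
  Cell (motion g @` body a) [set motion g @` F | F in faces a].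

Definition move_patch (g : 'M[R]_m * 'cV[R]_m) (P : set cell) : set cell :=
  move g @` P.

Definition congruent (a b : cell) : Prop := exists2 g, GE g & b = move g a.

Definition congruent_set (S T : set 'cV[R]_m) : Prop :=
  exists2 g, GE g & T = motion g @` S.

Definition congruent_patch (P Q : set cell) : Prop :=
  exists2 g, GE g & Q = move_patch g P.

Definition support (P : set cell) : set 'cV[R]_m := \bigcup_(a in P) body a.

Definition full_face_to_full_face (P : set cell) : Prop :=
  forall a b, P a -> P b -> a <> b ->
  forall F F', faces a F -> faces b F' -> overlap F F' -> F = F'.

End Polyhedra.
Arguments cell : clear implicits.

Section SubstitutionTilings.
Context {R : realType} {m : nat}.
Implicit Types (A x P Q : set (cell R m)) (a b j : cell R m).

Record alphabet A : Prop := {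
  alphabet_finite : finite_set A;
  alphabet_nonempty : A !=set0;
  alphabet_polyhedron : forall a, A a -> polyhedron a;
  alphabet_noncongruent : forall a b, A a -> A b -> congruent a b -> a = b }.

(* The types are the elements j of the alphabet; a is a tile of type j. *)
Definition of_type j a : Prop := congruent j a.

Definition is_tile A a : Prop := exists2 j, A j & of_type j a.

Record tiling A x : Prop := {
  tiling_tile : forall a, x a -> is_tile A a;
  tiling_cover : support x = setT;
  tiling_disjoint : forall a b, x a -> x b -> a <> b ->
    interior (body a) `&` interior (body b) = set0 }.

Definition patch A P : Prop := exists2 x, tiling A x & P `<=` x.

(* phi is a map from patches to patches; its values on sets of cells that are
   not patches are unconstrained. The constant l is |phi|. *)
Record substitution A (l : R) (phi : set (cell R m) -> set (cell R m)) : Prop := {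
  subst_patch : forall P, patch A P -> patch A (phi P);
  subst_union : forall P, patch A P -> phi P = \bigcup_(a in P) phi [set a];
  subst_gt1 : 1 < l;
  subst_equivariant : forall g P, GE g -> patch A P ->
    phi (move_patch g P) = move_patch (stretch_conj l g) (phi P);
  subst_stretch : forall a n, A a -> (0 < n)%N ->
    congruent_set [set l ^+ n *: v | v in body a]
      (support (iter n phi [set a]));
  subst_faces : forall a n, A a -> (0 < n)%N ->
    full_face_to_full_face (iter n phi [set a]);
  subst_types : forall a j, A a -> A j ->
    exists2 b, phi [set a] b & of_type j b }.

Definition subst_tilings A (phi : set (cell R m) -> set (cell R m)) :
    set (set (cell R m)) :=
  [set x | tiling A x /\
    forall P, finite_set P -> P `<=` x ->
    exists n a Q, [/\ (0 < n)%N, A a, Q `<=` iter n phi [set a]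
                    & congruent_patch P Q]].

Definition parallel a b : Prop := exists t, b = move (1%:M, t) a.

Definition rotations j a x : set 'M[R]_m :=
  [set r | SO r /\
    exists b, [/\ x b, of_type j b & parallel (move (r, 0) b) a]].

(* The group O_j(x), computed from a tile a of type j chosen in x; by orient_groupE below
   it does not depend on this choice. *)
Definition orient_group j x : set 'M[R]_m :=
  genSO (rotations j (xget j [set a | x a /\ of_type j a]) x).

End SubstitutionTilings.

Section OrientGroup.
Context {R : realType} {m : nat}.
Implicit Types (x : set (cell R m)) (a b j : cell R m).

Lemma SO_unit (r : 'M[R]_m) : SO r -> r \in unitmx.
Proof. by move=> [_ d1]; rewrite unitmxE d1 unitr1. Qed.

Lemma SO_inv (r : 'M[R]_m) : SO r -> SO (invmx r).
Proof.
move=> rSO; have ru := SO_unit rSO; case: (rSO) => rrT d1.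
have -> : invmx r = r^T by rewrite -[r^T]mul1mx -(mulVmx ru) -mulmxA rrT mulmx1.
by split; rewrite ?trmxK ?det_tr//; apply: mulmx1C.
Qed.

Lemma SO_mul (r s : 'M[R]_m) : SO r -> SO s -> SO (r *m s).
Proof.
move=> [r1 dr] [s1 ds]; split; last by rewrite det_mulmx dr ds mulr1.
by rewrite trmx_mul mulmxA -(mulmxA r) s1 mulmx1.
Qed.

Lemma move_comp (g h : 'M[R]_m * 'cV[R]_m) a :
  move g (move h a) = move (g.1 *m h.1, g.1 *m h.2 + g.2) a.
Proof.
have E : motion g \o motion h = motion (g.1 *m h.1, g.1 *m h.2 + g.2).
  by apply/funext => v; rewrite /motion /= mulmxDr mulmxA addrA.
case: a => B F; rewrite /move /= image_comp E; congr Cell.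
by rewrite image_comp; apply: eq_imagel => S _ /=; rewrite image_comp E.
Qed.

Lemma move1 a : move (1%:M, 0) a = a.
Proof.
have E : motion (1%:M, 0) = id :> ('cV[R]_m -> 'cV[R]_m).
  by apply/funext => v; rewrite /motion /= mul1mx addr0.
case: a => B F; rewrite /move /= E image_id; congr Cell.
by rewrite -[RHS]image_id; apply: eq_imagel => S _; rewrite image_id.
Qed.

Lemma rotationsE j a x : rotations j a x =
  [set r | SO r /\ exists b t, [/\ x b, of_type j b & a = move (r, t) b]].
Proof.
apply/seteqP; split=> r [rSO].
  move=> [b [xb jb [t ->]]]; split=> //; exists b, t; split=> //.
  by rewrite move_comp /= mul1mx mulmx0 add0r.
move=> [b [t [xb jb ->]]]; split=> //; exists b; split=> //; exists t.
by rewrite move_comp /= mul1mx mulmx0 add0r.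
Qed.

Lemma genSO_subgroup (S : set 'M[R]_m) : S `<=` SO -> subgroupSO (genSO S).
Proof.
have SO_sg : subgroupSO (SO : set 'M[R]_m).
  split=> //; [split; rewrite ?trmx1 ?mulmx1 ?det1// |exact: SO_mul|exact: SO_inv].
move=> SS; split.
- by move=> r; apply.
- by move=> H [[]].
- by move=> r s hr hs H HS; case: (HS) => -[_ _ HM _] _; apply: HM; [exact: hr|exact: hs].
- by move=> r hr H HS; case: (HS) => -[_ _ _ HV] _; apply: HV; exact: hr.
Qed.

Lemma orient_groupE j x a : x a -> of_type j a ->
  orient_group j x = genSO (rotations j a x).
Proof.
have sub (b c : cell R m) : x b -> of_type j b -> x c -> of_type j c ->
    genSO (rotations j b x) `<=` genSO (rotations j c x).
  move=> xb jb xc jc; apply: smallest_sub.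
    by apply: genSO_subgroup => r [].
  have [_ _ GM GV] : subgroupSO (genSO (rotations j c x)).
    by apply: genSO_subgroup => r [].
  move: (jb) (jc) => [[s u] sSO /= bE] [[s' u'] s'SO /= cE].
  rewrite /GE /= in sSO s'SO.
  pose q := s' *m invmx s.
  have qSO : SO q by apply: SO_mul => //; exact: SO_inv.
  have [v cbE] : exists v, c = move (q, v) b.
    exists (u' - q *m u); rewrite bE cE move_comp /=; congr move.
    by rewrite /q mulmxKV ?SO_unit// addrC subrK.
  rewrite rotationsE => r [rSO [d [t [xd jd bdE]]]].
  have hq : genSO (rotations j c x) q.
    by apply: sub_gen_smallest; rewrite rotationsE; split=> //; exists b, v.
  have hqr : genSO (rotations j c x) (q *m r).
    apply: sub_gen_smallest; rewrite rotationsE; split; first exact: SO_mul.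
    by exists d, (q *m t + v); split=> //; rewrite cbE bdE move_comp.
  by rewrite -(mulKmx (SO_unit qSO) r); apply: GM => //; exact: GV.
move=> xa ja; rewrite /orient_group.
case: xgetP => [b _ [xb jb]|/(_ a)/=]; last by case.
by apply/seteqP; split; apply: sub.
Qed.

End OrientGroup.

(* Main.v *)
(* Attach to a patch P and a type j the group Hol_j(P) generated by all r^-1 s,
   where r and s are the rotations of tiles of type j in P relative to the
   prototile j. It is monotone in P and, unlike the group generated by the
   r s^-1, it is unchanged when P is moved as a whole. Since phi^n a contains a
   copy of each phi^n' b with n' < n, the groups Hol_j(phi^n j) increase with n.
   Any finite patch of a tiling x of the system has a copy in some phi^n j, and
   x contains a copy of each phi^n j, so that Hol_j(x) is the union of the
   Hol_j(phi^n j) and does not depend on x. Moreover O_j(x) is conjugate to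
   Hol_j(x), and if s is the rotation of a tile of type k in phi j, then
   s^-1 Hol_j(P) s is contained in Hol_k(phi P). *)

From mathcomp Require Import all_boot all_order all_algebra.
From mathcomp Require Import all_classical all_reals all_analysis.
From mathcomp Require Import lra.
(* Imported last: [patch] and [support] also are names of MathComp. *)
Require Import Defs.

Set Implicit Arguments.
Unset Strict Implicit.
Unset Printing Implicit Defensive.

Import Order.TTheory GRing.Theory Num.Theory.
Import numFieldNormedType.Exports.

Local Open Scope classical_set_scope.
Local Open Scope ring_scope.

(** * Motions and polyhedra in the sup norm *)

Section Geometry.
Context {R : realType} {m : nat}.
Implicit Types (v w p q : 'cV[R]_m) (S T : set 'cV[R]_m) (r : 'M[R]_m)
  (g : 'M[R]_m * 'cV[R]_m) (a b : cell R m).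

Lemma cV_norm_leP v (c : R) :
  0 <= c -> (forall i, `|v i 0| <= c) -> `|v| <= c.
Proof.
move=> c0 h; rewrite /Num.norm /= mx_normrE; apply/bigmax_leP; split=> //= -[i j] _.
by rewrite ord1 /=.
Qed.

Lemma coord_norm_le v i : `|v i 0| <= `|v|.
Proof.
rewrite [leRHS]/Num.norm /= mx_normrE.
by apply: (@le_bigmax _ _ _ _ (fun ij => `|v ij.1 ij.2|) (i, 0)).
Qed.

(** By the diagonal of [r *m r^T = 1], the squares of the entries of each row sum to 1. *)
Lemma SO_entry_le1 r i j : SO r -> `|r i j| <= 1.
Proof.
case=> /matrixP/(_ i i); rewrite !mxE eqxx mulr1n (bigD1 j) //= !mxE => e1 _.
suff : `|r i j| ^+ 2 <= 1 by rewrite expr_le1.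
rewrite real_normK ?num_real// -e1 expr2 lerDl sumr_ge0// => k _.
by rewrite !mxE -expr2 sqr_ge0.
Qed.

(* The norm on R^m is the sup norm, which rotations distort by at most m. *)
Lemma SO_norm_le r v : SO r -> `|r *m v| <= m.+1%:R * `|v|.
Proof.
move=> rSO; apply: cV_norm_leP => [|i]; first by rewrite mulr_ge0.
rewrite mxE; apply: le_trans (ler_norm_sum _ _ _) _.
apply: (@le_trans _ _ (\sum_(k < m) `|v|)).
  apply: ler_sum => k _; rewrite normrM -[leRHS]mul1r.
  by apply: ler_pM => //; [exact: SO_entry_le1|exact: coord_norm_le].
by rewrite sumr_const card_ord -[_ *+ _]mulr_natl ler_wpM2r// ler_nat.
Qed.

Lemma motionB g v w : motion g v - motion g w = g.1 *m (v - w).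
Proof. by rewrite /motion mulmxBr opprD addrACA subrr addr0. Qed.

Lemma motion_dist g v w : GE g -> `|motion g v - motion g w| <= m.+1%:R * `|v - w|.
Proof. by move=> gG; rewrite motionB; exact: SO_norm_le. Qed.

Definition motion_inv g := (invmx g.1, - (invmx g.1 *m g.2)).

Lemma GE_motion_inv g : GE g -> GE (motion_inv g). Proof. exact: SO_inv. Qed.

Lemma motionK g : GE g -> cancel (motion g) (motion (motion_inv g)).
Proof.
by move=> gG v; rewrite /motion/= mulmxDr mulKmx ?addrK//; exact: SO_unit.
Qed.

Lemma motionVK g : GE g -> cancel (motion (motion_inv g)) (motion g).
Proof.
move=> gG v; rewrite /motion/= mulmxBr !mulKVmx ?subrK//; exact: SO_unit.
Qed.

Lemma moveK g : GE g -> cancel (move g) (move (motion_inv g)).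
Proof.
move=> gG a; rewrite move_comp /= subrr mulVmx; last exact: SO_unit.
exact: move1.
Qed.

Lemma interiorP S p :
  interior S p <-> exists2 e : R, 0 < e & forall v, `|v - p| < e -> S v.
Proof.
rewrite /interior; split=> [/nbhs_ballP [e e0]|[e e0 h]].
  rewrite -ball_normE => h.
  by exists e => // v vp; apply: h; rewrite /= distrC.
apply/nbhs_ballP; exists e => //; rewrite -ball_normE => v /= pv.
by apply: h; rewrite distrC.
Qed.

(** The inverse motion also stretches sup-norm distances by at most [m.+1]. Taking [m.+1] rather
    than [m] keeps the divisor positive when [m] is 0. *)
Lemma ball_motion g S p (e : R) : GE g ->
  (forall v, `|v - p| < e -> S v) ->
  forall v, `|v - motion g p| < e / m.+1%:R -> (motion g @` S) v.
Proof.
move=> gG h v vp; exists (motion (motion_inv g) v); last exact: motionVK.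
apply: h; rewrite -{1}(motionK gG p).
apply: le_lt_trans (motion_dist _ _ (GE_motion_inv gG)) _.
by rewrite mulrC -ltr_pdivlMr ?ltr0n.
Qed.

Lemma interior_motion g S p : GE g ->
  interior S p -> interior (motion g @` S) (motion g p).
Proof.
move=> gG /interiorP [e e0 h]; apply/interiorP; exists (e / m.+1%:R).
  by rewrite divr_gt0.
exact: ball_motion.
Qed.

(** Equivalently, [S] lies in the closure of its interior. *)
Definition regular S := forall p, S p -> forall e : R, 0 < e ->
  exists2 q, interior S q & `|q - p| < e.

Lemma regular_motion g S : GE g -> regular S -> regular (motion g @` S).
Proof.
move=> gG rS _ [p Sp <-] e e0.
have [|q iq qp] := rS p Sp (e / m.+1%:R); first by rewrite divr_gt0.
exists (motion g q); first exact: interior_motion.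
apply: le_lt_trans (motion_dist _ _ gG) _.
by rewrite mulrC -ltr_pdivlMr ?ltr0n.
Qed.

(** Distinct tiles of a tiling are only known to have disjoint interiors. This lemma turns a point
    of one tile interior to another into a common interior point, found by moving slightly into the
    interior of [S]. *)
Lemma regular_meet S T y : regular S -> interior T y -> S y ->
  interior S `&` interior T !=set0.
Proof.
move=> rS /interiorP [e e0 h] Sy.
have [|q iq qy] := rS y Sy (e / 2); first by rewrite divr_gt0.
exists q; split=> //; apply/interiorP; exists (e / 2); first by rewrite divr_gt0.
move=> v vq; apply: h; rewrite -(subrKA q).
by apply: le_lt_trans (ler_normD _ _) _; lra.
Qed.

Lemma conv_polytope_segment S p q (t : R) : conv_polytope S ->
  0 <= t -> t <= 1 -> S p -> S q -> S ((1 - t) *: p + t *: q).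
Proof.
case=> n [f ->] t0 t1 [w [w0 w1 ->]] [u [u0 u1 ->]].
exists (fun i => (1 - t) * w i + t * u i); split.
- by move=> i; rewrite addr_ge0// mulr_ge0// subr_ge0.
- by rewrite big_split /= -!mulr_sumr w1 u1; lra.
- rewrite !scaler_sumr -big_split /=; apply: eq_bigr => i _.
  by rewrite [RHS]scalerDl !scalerA.
Qed.

Lemma conv_polytope_bounded S : conv_polytope S ->
  exists M : R, forall v, S v -> `|v| <= M.
Proof.
case=> n [f ->]; exists (\sum_i `|f i|) => _ [w [w0 w1 ->]].
apply: le_trans (ler_norm_sum _ _ _) _; apply: ler_sum => i _.
rewrite normrZ -[leRHS]mul1r ler_wpM2r// ger0_norm// -w1 (bigD1 i) //= lerDl.
by rewrite sumr_ge0.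
Qed.

(** The homothety with centre [p] and ratio [t] maps a ball around the interior point [q] to a ball
    inside [S], whose centre tends to [p] with [t]. *)
Lemma conv_polytope_regular S : conv_polytope S -> interior S !=set0 -> regular S.
Proof.
move=> cS [q /interiorP [d d0 hd]] p Sp e e0.
(* The summand 1 makes [D] positive and larger than the distance from [p] to [q], so that [t] times
   this distance is less than [e], even if [q = p]. *)
pose D := `|q - p| + 1.
have D0 : 0 < D by rewrite ltr_wpDl.
pose t := Num.min 1 (e / D).
have t0 : 0 < t by rewrite lt_min ltr01 divr_gt0.
have t1 : t <= 1 by rewrite ge_min lexx.
exists ((1 - t) *: p + t *: q).
  apply/interiorP; exists (t * d); first exact: mulr_gt0.
  move=> v hv; have -> : v = (1 - t) *: p + t *: (t^-1 *: (v - (1 - t) *: p)).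
    by rewrite scalerA divff ?gt_eqF// scale1r addrC subrK.
  apply: conv_polytope_segment => //; first exact: ltW.
  apply: hd; rewrite -(@ltr_pM2l _ t)// -[X in X * `|_|](gtr0_norm t0) -normrZ.
  rewrite scalerBr scalerA divff ?gt_eqF// scale1r.
  by rewrite -addrA -opprD.
have -> : (1 - t) *: p + t *: q - p = t *: (q - p).
  by rewrite scalerBl scale1r scalerBr addrC !addrA addNr add0r addrC.
rewrite normrZ gtr0_norm//.
apply: (@lt_le_trans _ _ (t * D)); first by rewrite ltr_pM2l// ltrDl.
by rewrite -ler_pdivlMr// ge_min lexx orbT.
Qed.

Lemma polyhedral_bounded S : polyhedral_in setT S ->
  exists M : R, forall v, S v -> `|v| <= M.
Proof.
case=> n [Q [hQ ->]].
have /choice [M hM] : forall i, exists M : R, forall v, Q i v -> `|v| <= M.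
  by move=> i; apply: conv_polytope_bounded; case: (hQ i).
exists (\big[Num.max/0]_i M i) => v [i _ Qv].
by apply: le_trans (hM i v Qv) _; apply: le_bigmax.
Qed.

Lemma relintT S : relint setT S = interior S.
Proof.
by apply/seteqP; split=> p; rewrite /relint /interior /= withinET => // -[].
Qed.

Lemma polyhedral_regular S : polyhedral_in setT S -> regular S.
Proof.
case=> n [Q [hQ ->]] p [i _ Qp] e e0.
have [cQ _] := hQ i; rewrite relintT => iQ.
have [q iq qp] := conv_polytope_regular cQ iQ Qp e0.
by exists q => //; apply: interiorS iq => v Qv; exists i.
Qed.

Lemma polyhedral_interior S : polyhedral_in setT S -> interior S !=set0.
Proof.
case=> n [Q [hQ ->]]; have [_ _] := hQ ord0; rewrite relintT => -[q iq].
by exists q; apply: interiorS iq => v Qv; exists ord0.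
Qed.

(** Pigeonhole principle: the ball of radius [B] is cut into finitely many boxes of side [e / 2],
    and two points in the same box are closer than [e]. *)
Lemma separated_finite (T : Type) (P : set T) (c : T -> 'cV[R]_m) (B e : R) :
  0 < e -> (forall x, P x -> `|c x| <= B) ->
  (forall x y, P x -> P y -> `|c x - c y| < e -> x = y) -> finite_set P.
Proof.
move=> e0 hB sep.
(* Index of the box along coordinate [i]; adding [B] makes the argument of [truncn] nonnegative on
   [P]. *)
pose k v i := Num.truncn ((v i 0 + B) / (e / 2)).
pose N := (Num.truncn ((B + B) / (e / 2))).+1.
(* On [P] the index is below [N], by [fE], so that [inord] never falls back on its default value
   there. *)
pose f x : {ffun 'I_m -> 'I_N} := [ffun i => inord (k (c x) i)].
have e20 : 0 < e / 2 by rewrite divr_gt0.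
have coordB x i : P x -> 0 <= c x i 0 + B /\ c x i 0 <= B.
  move=> Px; have := le_trans (coord_norm_le (c x) i) (hB x Px).
  by rewrite ler_norml => /andP[h1 h2]; split=> //; lra.
have fE x i : P x -> f x i = k (c x) i :> nat.
  move=> Px; rewrite ffunE inordK// ltnS; apply: le_truncn.
  have [_ h] := coordB x i Px.
  by rewrite ler_pM2r ?invr_gt0// lerD2r.
suff /inj_card_eq/eq_finite_set <- : {in P &, injective f} by exact: finite_finset.
move=> x y /set_mem Px /set_mem Py fxy; apply: sep => //.
have he : forall i, `|(c x - c y) i 0| <= e / 2.
  move=> i; rewrite !mxE.
  have kE : k (c x) i = k (c y) i by rewrite -!fE// fxy.
  have [hx _] := coordB x i Px; have [hy _] := coordB y i Py.
  have /truncn_itv /andP[x1 x2] : 0 <= (c x i 0 + B) / (e / 2) by rewrite divr_ge0// ltW.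
  have /truncn_itv /andP[y1 y2] : 0 <= (c y i 0 + B) / (e / 2) by rewrite divr_ge0// ltW.
  move: x1 x2 y1 y2; rewrite ler_norml -/(k (c x) i) -/(k (c y) i) kE -(addn1 (k _ _)) natrD.
  rewrite !(ler_pdivlMr _ _ e20) !(ltr_pdivrMr _ _ e20) mulrDl mul1r => *.
  by apply/andP; split; lra.
apply: (@le_lt_trans _ _ (e / 2)); last by lra.
by apply: cV_norm_leP => //; exact: ltW.
Qed.

End Geometry.

(** * Patches and local finiteness of tilings *)

Section Patches.
Context {R : realType} {m : nat}.
Implicit Types (A x P Q : set (cell R m)) (a b c : cell R m)
  (g h : 'M[R]_m * 'cV[R]_m).

Definition motion_comp g h := (g.1 *m h.1, g.1 *m h.2 + g.2).

Lemma GE_motion_comp g h : GE g -> GE h -> GE (motion_comp g h). Proof. exact: SO_mul. Qed.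

Lemma move_patch_comp g h P :
  move_patch g (move_patch h P) = move_patch (motion_comp g h) P.
Proof.
by rewrite /move_patch image_comp; apply: eq_imagel => a _; exact: move_comp.
Qed.

Lemma move_patch1 g a : move_patch g [set a] = [set move g a].
Proof. exact: image_set1. Qed.

Lemma support_move g P : support (move_patch g P) = motion g @` support P.
Proof. by rewrite /support /move_patch bigcup_image image_bigcup. Qed.

Lemma interior_body_motion_inv g a q : GE g ->
  interior (body (move g a)) q -> interior (body a) (motion (motion_inv g) q).
Proof.
move=> gG /(interior_motion (GE_motion_inv gG)).
by rewrite -[_ @` _]/(body (move (motion_inv g) (move g a))) moveK.
Qed.

Lemma is_tile_move A g a : GE g -> is_tile A a -> is_tile A (move g a).
Proof.
move=> gG [j Aj [h hG ->]]; exists j => //; rewrite move_comp.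
by exists (motion_comp g h) => //; exact: GE_motion_comp.
Qed.

Lemma tiling_move A g x : GE g -> tiling A x -> tiling A (move_patch g x).
Proof.
move=> gG [tx cx dx]; split.
- by move=> _ [a xa <-]; apply: is_tile_move => //; exact: tx.
- rewrite support_move cx; apply/seteqP; split=> // v _.
  by exists (motion (motion_inv g) v) => //; exact: motionVK.
- move=> _ _ [a xa <-] [b xb <-] ab.
  apply/seteqP; split=> // q [/(interior_body_motion_inv gG) qa /(interior_body_motion_inv gG) qb].
  have {}ab : a <> b by move=> ab'; apply: ab; rewrite ab'.
  suff : set0 (motion (motion_inv g) q) by [].
  by rewrite -(dx a b).
Qed.

Lemma patch_move A g P : GE g -> patch A P -> patch A (move_patch g P).
Proof.
move=> gG [x tx Px]; exists (move_patch g x); first exact: tiling_move.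
exact: image_subset.
Qed.

Lemma patchS A P Q : P `<=` Q -> patch A Q -> patch A P.
Proof. by move=> PQ [x tx Qx]; exists x => //; exact: subset_trans Qx. Qed.

Lemma patch_tile A P a : patch A P -> P a -> is_tile A a.
Proof. by move=> [x [tx _ _] Px] /Px /tx. Qed.

Lemma patch_eq A P a b : patch A P -> P a -> P b ->
  interior (body a) `&` interior (body b) !=set0 -> a = b.
Proof.
move=> [x [_ _ dx] Px] /Px xa /Px xb ab; apply: contrapT => nab.
by case: ab => q; rewrite dx.
Qed.

Lemma finite_upper (T : eqType) (B : set T) (f : T -> R) :
  finite_set B -> exists2 M : R, 0 < M & forall t, B t -> f t <= M.
Proof.
(* Starting the maximum at 1 makes the bound positive, even for an empty set. *)
case/finite_seqP => s ->; exists (\big[Num.max/1]_(t <- s) f t).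
  by apply: lt_le_trans ltr01 (bigmax_ge_id _ _ _ _).
by move=> t st; apply: le_bigmax_seq.
Qed.

End Patches.

(** * Uniform bounds on the size of tiles *)

Section Tiles.
Context {R : realType} {m : nat} (A : set (cell R m)) (hA : alphabet A).
Implicit Types (x P : set (cell R m)) (a : cell R m).

Lemma tile_regular a : is_tile A a -> regular (body a).
Proof.
move=> [j Aj [g gG ->]]; apply: regular_motion => //.
apply: polyhedral_regular; apply: polyhedron_body.
exact: (alphabet_polyhedron hA).
Qed.

Lemma tile_interior a : is_tile A a -> interior (body a) !=set0.
Proof.
move=> [j Aj [g gG ->]].
have [p ip] : interior (body j) !=set0.
  apply: polyhedral_interior; apply: polyhedron_body.
  exact: (alphabet_polyhedron hA).
by exists (motion g p); exact: interior_motion.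
Qed.

Lemma prototile_bounded :
  exists2 M : R, 0 < M & forall a v, A a -> body a v -> `|v| <= M.
Proof.
have /choice [f hf] : forall a, exists M : R, A a -> forall v, body a v -> `|v| <= M.
  move=> a; have [Aa|nAa] := pselect (A a); last by exists 0.
  have [M hM] := polyhedral_bounded (polyhedron_body (alphabet_polyhedron hA Aa)).
  by exists M.
have [M M0 hM] := finite_upper f (alphabet_finite hA).
by exists M => // a v Aa av; apply: le_trans (hf a Aa v av) (hM a Aa).
Qed.

Lemma tile_bounded : exists D : R, forall a u v,
  is_tile A a -> body a u -> body a v -> `|u - v| <= D.
Proof.
have [M M0 hM] := prototile_bounded.
exists (m.+1%:R * (M + M)) => _ _ _ [j Aj [g gG ->]] [u ju <-] [v jv <-].
apply: le_trans (motion_dist _ _ gG) _; rewrite ler_wpM2l//.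
by apply: le_trans (ler_normB _ _) _; rewrite lerD//; exact: hM ju || exact: hM jv.
Qed.

(** Each prototile contains a ball and there are finitely many prototiles, so one radius serves them
    all; motions shrink it by at most the factor [m.+1]. *)
Lemma tile_inball : exists2 e : R, 0 < e & forall a, is_tile A a ->
  exists c, forall v, `|v - c| < e -> body a v.
Proof.
have /choice [f hf] : forall a, exists p : R * 'cV[R]_m, A a ->
    0 < p.1 /\ forall v, `|v - p.2| < p.1 -> body a v.
  move=> a; have [Aa|nAa] := pselect (A a); last by exists (0, 0).
  have [c /interiorP [e e0 h]] :=
    polyhedral_interior (polyhedron_body (alphabet_polyhedron hA Aa)).
  by exists (e, c).
(* An upper bound for the inverses of the radii gives a positive lower bound for the radii. *)
have [M M0 hM] := finite_upper (fun a => (f a).1^-1) (alphabet_finite hA).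
exists (M^-1 / m.+1%:R); first by rewrite divr_gt0 ?invr_gt0.
move=> _ [j Aj [g gG ->]]; have [e0 h] := hf j Aj.
exists (motion g (f j).2); apply: ball_motion => // v hv.
apply: h; apply: lt_le_trans hv _.
by rewrite -[leRHS]invrK lef_pV2 ?posrE ?invr_gt0//; exact: hM.
Qed.

(** Every tile contains a ball of a fixed radius [e]. If the centres of two such balls are less than
    [e] apart, the tiles share an interior point and coincide. As tiles have bounded diameter, the
    centres in question are bounded, and [separated_finite] applies. *)
Lemma tiling_locally_finite x (B : R) : tiling A x ->
  finite_set [set a | x a /\ exists2 v, body a v & `|v| <= B].
Proof.
move=> tx; have [D hD] := tile_bounded; have [e e0 he] := tile_inball.
have /choice [c hc] : forall a, exists c, x a -> forall v, `|v - c| < e -> body a v.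
  move=> a; have [xa|] := pselect (x a); last by exists 0.
  by have [c hc] := he a (tiling_tile tx xa); exists c.
have bodyc a : x a -> body a (c a).
  by move=> xa; apply: hc => //; rewrite subrr normr0.
have intc a v : x a -> `|v - c a| < e -> interior (body a) v.
  move=> xa av; apply/interiorP; exists (e - `|v - c a|); first by rewrite subr_gt0.
  move=> w wv; apply: hc => //; rewrite -(subrKA v).
  by apply: le_lt_trans (ler_normD _ _) _; rewrite -ltrBrDr.
apply: (@separated_finite _ _ _ _ c (B + D) e) => //.
  move=> a [xa [v av vB]]; rewrite -(subrK v (c a)) addrC.
  apply: le_trans (ler_normD _ _) _; rewrite lerD//.
  by apply: (hD a) => //; [exact: tiling_tile tx _ xa|exact: bodyc].
move=> a b [xa _] [xb _] ab; apply: contrapT => nab.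
have : (interior (body a) `&` interior (body b)) (c a).
  by split; apply: intc => //; rewrite subrr normr0.
by rewrite (tiling_disjoint tx).
Qed.

End Tiles.

(** * Supertiles *)

Section Iterates.
Context {R : realType} {m : nat} (A : set (cell R m)) (l : R)
  (phi : set (cell R m) -> set (cell R m)).
Hypotheses (hA : alphabet A) (hphi : substitution A l phi).
Implicit Types (x P Q : set (cell R m)) (a b c j : cell R m).

Lemma iter_patch n P : patch A P -> patch A (iter n phi P).
Proof. by move=> pP; elim: n => //= n; exact: (subst_patch hphi). Qed.

Lemma iter_union n P : patch A P ->
  iter n phi P = \bigcup_(a in P) iter n phi [set a].
Proof.
move=> pP; elim: n => [|n IHn] /=; first by rewrite bigcup_imset1 image_id.
rewrite (subst_union hphi) ?IHn; last by rewrite -IHn; exact: iter_patch.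
apply/seteqP; split=> b.
  move=> [c [a Pa ac] cb]; exists a => //; rewrite (subst_union hphi); first by exists c.
  by apply: iter_patch; apply: patchS pP => _ ->.
move=> [a Pa]; rewrite (subst_union hphi).
  by move=> [c ac cb]; exists c => //; exists a.
by apply: iter_patch; apply: patchS pP => _ ->.
Qed.

Lemma iter_subset n P Q : P `<=` Q -> patch A Q -> iter n phi P `<=` iter n phi Q.
Proof.
move=> PQ pQ; rewrite (iter_union n pQ) (iter_union n (patchS PQ pQ)).
by apply: bigcup_subset.
Qed.

Lemma iter_equivariant n g P : GE g -> patch A P ->
  iter n phi (move_patch g P) =
  move_patch (stretch_conj (l ^+ n) g) (iter n phi P).
Proof.
move=> gG pP; elim: n => [|n IHn] /=.
  by case: g gG => r t _; rewrite /stretch_conj /= expr0 scale1r.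
rewrite IHn (subst_equivariant hphi) ?/stretch_conj ?scalerA ?exprS//.
exact: iter_patch.
Qed.

(** The axioms on [phi] speak of patches only, so prototiles must be shown to be patches; this
    becomes the hypothesis [pA] below. A tile of [x] provides one prototile [j], and [phi [set j]]
    then provides all the others. *)
Lemma prototile_patch x a : subst_tilings A phi x -> A a -> patch A [set a].
Proof.
move=> [tx _] Aa; have [c xc _] : support x 0 by rewrite (tiling_cover tx).
have [j Aj [g gG cE]] := tiling_tile tx xc.
have pj : patch A [set j].
  rewrite -(moveK gG j) -cE -move_patch1; apply: patch_move; first exact: GE_motion_inv.
  by exists x => // _ ->.
have [b jb [h hG bE]] := subst_types hphi Aj Aa.
rewrite -(moveK hG a) -bE -move_patch1; apply: patch_move; first exact: GE_motion_inv.
by apply: patchS (subst_patch hphi pj) => _ ->.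
Qed.

Context (pA : forall a, A a -> patch A [set a]).

Lemma iter_set1_move n g a : GE g -> A a ->
  iter n phi [set move g a] =
  move_patch (stretch_conj (l ^+ n) g) (iter n phi [set a]).
Proof. by move=> gG Aa; rewrite -move_patch1 iter_equivariant//; exact: pA. Qed.

Lemma iter_types n a j : A a -> A j -> (0 < n)%N ->
  exists2 g, GE g & iter n phi [set a] (move g j).
Proof.
move=> Aa Aj; elim: n => // -[_ _|n /(_ isT) [g gG ag] _].
  by have [b ab [g gG bE]] := subst_types hphi Aa Aj; exists g; rewrite -?bE.
(* A tile of type [j] already found yields another one at the next order, since [phi [set j]]
   contains a tile of type [j]. *)
have [b jb [h hG bE]] := subst_types hphi Aj Aj.
exists (motion_comp (stretch_conj l g) h); first exact: GE_motion_comp.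
rewrite iterS (subst_union hphi); last exact/iter_patch/pA.
exists (move g j) => //; have := iter_set1_move 1 gG Aj.
rewrite /= expr1 => ->; exists (move h j); first by rewrite -bE.
exact: move_comp.
Qed.

(** The patch [phi^(n' - n) b] contains a copy of [a]; applying [phi^n] to it gives the
    inclusion. *)
Lemma iter_embed n n' a b : (n < n')%N -> A a -> A b ->
  exists2 g, GE g & move_patch g (iter n phi [set a]) `<=` iter n' phi [set b].
Proof.
move=> nn' Aa Ab; have [|g gG bg] := @iter_types (n' - n) b a Ab Aa.
  by rewrite subn_gt0.
exists (stretch_conj (l ^+ n) g) => //.
rewrite -iter_set1_move// -(subnKC (ltnW nn')) iterD.
by apply: iter_subset => [_ ->//|]; exact/iter_patch/pA.
Qed.

Lemma supertile_bounded n : (0 < n)%N -> exists2 D : R, 0 <= D & forall c u v,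
  is_tile A c -> support (iter n phi [set c]) u ->
  support (iter n phi [set c]) v -> `|u - v| <= D.
Proof.
move=> n0; have [M M0 hM] := prototile_bounded hA.
(* One factor [m.+1] is for the motion placing the tile, the other for the motion between the
   supertile and the stretched prototile. *)
exists (m.+1%:R * (m.+1%:R * (`|l ^+ n| * (M + M)))).
  by rewrite !mulr_ge0// addr_ge0// ltW.
move=> _ u v [a Aa [g gG ->]].
rewrite iter_set1_move// support_move.
have [h hG ->] := subst_stretch hphi Aa n0.
move=> [_ [_ [u' au <-] <-] <-] [_ [_ [v' av <-] <-] <-].
apply: le_trans (motion_dist _ _ _) _; first exact: gG.
rewrite ler_wpM2l//; apply: le_trans (motion_dist _ _ hG) _.
rewrite ler_wpM2l// -scalerBr normrZ ler_wpM2l//.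
by apply: le_trans (ler_normB _ _) _; rewrite lerD//; exact: (hM a).
Qed.

(** Strengthens the definition of the tiling system: by [iter_embed], the prototile can be
    prescribed and the order made as large as desired. *)
Lemma finite_subpatch x P n a : subst_tilings A phi x -> A a ->
  finite_set P -> P `<=` x -> exists n' g,
    [/\ (n < n')%N, GE g & move_patch g P `<=` iter n' phi [set a]].
Proof.
move=> [_ hx] Aa fP Px; have [k [b [Q [k0 Ab Qk [g gG QE]]]]] := hx P fP Px.
have [|h hG kh] := @iter_embed k (k + n).+1 b a _ Ab Aa.
  by rewrite ltnS leq_addr.
exists (k + n).+1, (motion_comp h g); split; first by rewrite ltnS leq_addl.
  exact: GE_motion_comp.
rewrite -move_patch_comp -QE; apply: subset_trans kh; exact: image_subset.
Qed.

(* A tile of [x] at the origin lies in some [phi^n c] inside a large supertile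
   containing the tiles of [x] close to the origin. These tiles already cover
   [phi^n c], whence they include it. *)
Lemma tiling_contains_supertile x n : subst_tilings A phi x -> (0 < n)%N ->
  exists g a, [/\ GE g, A a & move_patch g (iter n phi [set a]) `<=` x].
Proof.
move=> hx n0; have [D D0 hD] := supertile_bounded n0; have [tx _] := hx.
(* The supertile to be found has diameter at most [D]; the factor [m.+1] allows for carrying it back
   to [x] by the inverse of [h]. *)
pose P := [set a | x a /\ exists2 v, body a v & `|v| <= m.+1%:R * D].
have fP : finite_set P by exact: (tiling_locally_finite hA).
have [a Aa] := alphabet_nonempty hA.
have [|n' [h [nn' hG hP]]] := finite_subpatch n hx Aa fP; first by move=> ? [].
have pn' : patch A (iter n' phi [set a]) by exact/iter_patch/pA.
have n'E : iter n' phi [set a] =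
    \bigcup_(c in iter (n' - n) phi [set a]) iter n phi [set c].
  by rewrite -{1}(subnKC (ltnW nn')) iterD iter_union//; exact/iter_patch/pA.
have [d xd d0] : support x 0 by rewrite (tiling_cover tx).
have /hP : move_patch h P (move h d).
  by exists d => //; split=> //; exists 0 => //; rewrite normr0 mulr_ge0.
rewrite n'E => -[c dc cd].
have tc : is_tile A c by apply: patch_tile dc; exact/iter_patch/pA.
have hc0 : support (iter n phi [set c]) (motion h 0).
  by exists (move h d) => //; exists 0.
have [b Ab [g gG cE]] := tc.
exists (motion_comp (motion_inv h) (stretch_conj (l ^+ n) g)), b; split=> //.
  by apply: GE_motion_comp => //; exact: GE_motion_inv.
rewrite -move_patch_comp -iter_set1_move// -cE => _ [e ce <-].
have n'e : iter n' phi [set a] e by rewrite n'E; exists c.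
(* Any tile [e] of the supertile is recognized by an interior point [y]: the tile [f] of [x]
   covering the preimage of [y] belongs to [P], and its image under [h] must be [e]. *)
have [y ey] := tile_interior hA (patch_tile pn' n'e).
have [f xf fy] : support x (motion (motion_inv h) y) by rewrite (tiling_cover tx).
have n'f : iter n' phi [set a] (move h f).
  apply: hP; exists f => //; split=> //; exists (motion (motion_inv h) y) => //.
  rewrite -[_ y]subr0 -(motionK hG 0).
  apply: le_trans (motion_dist _ _ (GE_motion_inv hG)) _; rewrite ler_wpM2l//.
  apply: hD tc _ hc0; exists e => //; exact: interior_subset ey.
suff -> : e = move h f by rewrite moveK.
apply: (patch_eq pn' n'e n'f); rewrite setIC.
apply: (regular_meet _ ey); first exact: (tile_regular hA (patch_tile pn' n'f)).
by exists (motion (motion_inv h) y) => //; exact: motionVK.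
Qed.

(** The previous lemma leaves the type of the supertile open. Going up to order [n.+1] removes this
    restriction, since every supertile of that order contains copies of [phi^n a] for all prototiles
    [a]; it also allows [n = 0]. *)
Lemma tiling_contains_iter x n a : subst_tilings A phi x -> A a ->
  exists2 g, GE g & move_patch g (iter n phi [set a]) `<=` x.
Proof.
move=> hx Aa; have [g [b [gG Ab bx]]] := tiling_contains_supertile hx (ltn0Sn n).
have [h hG ab] := iter_embed (ltnSn n) Aa Ab.
exists (motion_comp g h); first exact: GE_motion_comp.
rewrite -move_patch_comp; apply: subset_trans bx; exact: image_subset.
Qed.

End Iterates.

(** * Holonomy groups *)

Section Holonomy.
Context {R : realType} {m : nat}.
Implicit Types (P Q x : set (cell R m)) (a b j k : cell R m) (r s q : 'M[R]_m)
  (g : 'M[R]_m * 'cV[R]_m) (S H K : set 'M[R]_m).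

Lemma invmx_SOM r s : SO r -> SO s -> invmx (r *m s) = invmx s *m invmx r.
Proof.
move=> rS sS; have rsu := SO_unit (SO_mul rS sS).
apply: (can_inj (mulKmx rsu)); rewrite mulmxV// -mulmxA mulKVmx ?SO_unit//.
by rewrite mulmxV// SO_unit.
Qed.

Lemma conjSO_subset s H K : H `<=` K -> conjSO s H `<=` conjSO s K.
Proof. exact: image_subset. Qed.

Lemma conjSOM s r H : SO s -> SO r -> conjSO s (conjSO r H) = conjSO (s *m r) H.
Proof.
move=> sS rS; rewrite /conjSO image_comp; apply: eq_imagel => q _ /=.
by rewrite invmx_SOM// !mulmxA.
Qed.

Lemma conjSO1 H : conjSO 1%:M H = H.
Proof.
rewrite /conjSO -[RHS]image_id; apply: eq_imagel => q _ /=.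
by rewrite invmx1 mul1mx mulmx1.
Qed.

Lemma conjSO_subgroup s H : SO s -> subgroupSO H -> subgroupSO (conjSO s H).
Proof.
move=> sS [HS H1 HM HV]; have su := SO_unit sS; split.
- move=> _ [r Hr <-]; apply: SO_mul (SO_inv sS); apply: SO_mul => //; exact: HS.
- by exists 1%:M => //; rewrite mulmx1 mulmxV.
- move=> _ _ [r Hr <-] [q Hq <-]; exists (r *m q); first exact: HM.
  by rewrite -!mulmxA mulKmx.
- move=> _ [r Hr <-]; exists (invmx r); first exact: HV.
  have rS := HS _ Hr; rewrite !invmx_SOM ?invmxK ?mulmxA//; last exact: SO_inv.
  exact: SO_mul.
Qed.

(** A symmetric prototile gives several rotations for one and the same tile; all of them are kept,
    as in [rotations]. *)
Definition poses j P : set 'M[R]_m :=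
  [set s | SO s /\ exists t, P (move (s, t) j)].

(* Unlike [rotations], these relative rotations are read in the frame of the
   prototile [j], so that they do not change when the whole patch is moved. *)
Definition relative_poses j P : set 'M[R]_m :=
  [set q | exists r s, [/\ poses j P r, poses j P s & q = invmx r *m s]].

Definition holonomy j P : set 'M[R]_m := genSO (relative_poses j P).

Lemma relative_poses_SO j P : relative_poses j P `<=` SO.
Proof.
by move=> _ [r [s [[rS _] [sS _] ->]]]; apply: SO_mul => //; exact: SO_inv.
Qed.

Lemma holonomy_subgroup j P : subgroupSO (holonomy j P).
Proof. exact/genSO_subgroup/relative_poses_SO. Qed.

Lemma holonomy_sub j P H : subgroupSO H -> relative_poses j P `<=` H ->
  holonomy j P `<=` H.
Proof. exact: smallest_sub. Qed.

Lemma relative_poses_holonomy j P : relative_poses j P `<=` holonomy j P.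
Proof. exact: sub_gen_smallest. Qed.

Lemma poses_subset j P Q : P `<=` Q -> poses j P `<=` poses j Q.
Proof. by move=> PQ s [sS [t Ps]]; split=> //; exists t; exact: PQ. Qed.

Lemma holonomy_subset j P Q : P `<=` Q -> holonomy j P `<=` holonomy j Q.
Proof.
move=> PQ; apply: holonomy_sub; first exact: holonomy_subgroup.
move=> _ [r [s [Pr Ps ->]]]; apply: relative_poses_holonomy.
by exists r, s; split=> //; exact: poses_subset PQ _ _.
Qed.

Lemma poses_move g j P s : GE g -> poses j P s ->
  poses j (move_patch g P) (g.1 *m s).
Proof.
move=> gG [sS [t Ps]]; split; first exact: SO_mul.
by exists (g.1 *m t + g.2); exists (move (s, t) j) => //; exact: move_comp.
Qed.

(** The motion multiplies all poses on the left by [g.1], which cancels in [invmx r *m s]. *)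
Lemma holonomy_move g j P : GE g -> holonomy j P `<=` holonomy j (move_patch g P).
Proof.
move=> gG; apply: holonomy_sub; first exact: holonomy_subgroup.
move=> _ [r [s [Pr Ps ->]]]; apply: relative_poses_holonomy.
exists (g.1 *m r), (g.1 *m s); split; [exact: poses_move..|].
have [rS _] := Pr; rewrite invmx_SOM// -mulmxA mulKmx//; exact: SO_unit.
Qed.

Lemma holonomy_move_subset g j P Q : GE g -> move_patch g P `<=` Q ->
  holonomy j P `<=` holonomy j Q.
Proof.
by move=> gG PQ; apply: subset_trans (holonomy_subset PQ); exact: holonomy_move.
Qed.

(** Together with the reverse inclusion below, this identifies [orient_group j x] with the conjugate
    of the holonomy group by the rotation of any tile of type [j] in [x]. *)
Lemma orient_group_sub j x r t : SO r -> x (move (r, t) j) ->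
  orient_group j x `<=` conjSO r (holonomy j x).
Proof.
move=> rS xr; rewrite (orient_groupE xr); last by exists (r, t).
apply: smallest_sub; first by apply: conjSO_subgroup => //; exact: holonomy_subgroup.
rewrite rotationsE => q [qS [b [u [xb [[s v] sS bE] rE]]]].
rewrite /GE /= in sS; rewrite bE in xb; rewrite bE move_comp /= in rE.
have [_ _ HM _] := holonomy_subgroup j x.
have xs : poses j x s by split=> //; exists v.
have xr' : poses j x r by split=> //; exists t.
(* This is again a pose of the base tile, possibly different from [r] if [j] has symmetries. *)
have xqs : poses j x (q *m s).
  by split; [exact: SO_mul|exists (q *m v + u); rewrite -rE].
exists (invmx r *m (q *m s) *m (invmx s *m r)).
  apply: HM; apply: relative_poses_holonomy; first by exists r, (q *m s).
  by exists s, r.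
have ru := SO_unit rS; have su := SO_unit sS.
by rewrite !mulmxA mulmxV// mul1mx mulmxK// mulmxK.
Qed.

Lemma conjSO_sub_orient_group j x r t : SO r -> x (move (r, t) j) ->
  conjSO r (holonomy j x) `<=` orient_group j x.
Proof.
move=> rS xr.
have ru := SO_unit rS.
have jr : of_type j (move (r, t) j) by exists (r, t).
have rotSO : rotations j (move (r, t) j) x `<=` SO by move=> ? [].
have [oS o1 oM oV] := genSO_subgroup rotSO.
(* The conjugation by [r] is moved to the right-hand side, so that the inclusion need only be
   checked on the generators of the holonomy group. *)
rewrite (orient_groupE xr jr) -[X in _ `<=` X]conjSO1 -(mulmxV ru).
rewrite -conjSOM//; last exact: SO_inv.
apply: conjSO_subset; apply: holonomy_sub.
  by apply: conjSO_subgroup; [exact: SO_inv|exact: genSO_subgroup].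
have rotP s : poses j x s -> genSO (rotations j (move (r, t) j) x) (r *m invmx s).
  move=> [sS [u xs]]; apply: sub_gen_smallest; rewrite rotationsE; split.
    by apply: SO_mul => //; exact: SO_inv.
  exists (move (s, u) j), (t - r *m invmx s *m u); split=> //; first by exists (s, u).
  by rewrite move_comp /= mulmxKV ?SO_unit// addrC subrK.
move=> _ [s [q [xs xq ->]]].
(* With both factors read as rotations onto the base tile, conjugating [invmx s *m q] by [r] gives
   the quotient of the one for [s] by the one for [q]. *)
exists (r *m invmx s *m invmx (r *m invmx q)).
  by apply: oM; [exact: rotP|apply: oV; exact: rotP].
have [sS _] := xs; have [qS _] := xq.
rewrite invmx_SOM//; last exact: SO_inv.
by rewrite !invmxK -!mulmxA mulKmx// mulVmx// mulmx1.
Qed.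

End Holonomy.

Lemma bigcup_subgroupSO (R : realType) (m : nat) (H : nat -> set 'M[R]_m) :
  (forall n, subgroupSO (H n)) ->
  (forall n n', (n <= n')%N -> H n `<=` H n') ->
  subgroupSO (\bigcup_n H n).
Proof.
move=> sH incr; split.
- by move=> r [n _]; case: (sH n) => + _ _ _; exact.
- by exists 0%N => //; case: (sH 0%N).
- move=> r s [n _ nr] [n' _ ns]; exists (maxn n n') => //.
  have [_ _ HM _] := sH (maxn n n').
  by apply: HM; [exact: (incr n _ (leq_maxl _ _))|exact: (incr n' _ (leq_maxr _ _))].
- by move=> r [n _ nr]; exists n => //; case: (sH n) => _ _ _; exact.
Qed.

(** * Holonomy groups of supertiles and of tilings *)

Section HolonomyOfTilings.
Context {R : realType} {m : nat} (A : set (cell R m)) (l : R)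
  (phi : set (cell R m) -> set (cell R m)).
Hypotheses (hA : alphabet A) (hphi : substitution A l phi).
Hypothesis pA : forall a, A a -> patch A [set a].
Implicit Types (x P : set (cell R m)) (j k : cell R m).

Lemma holonomy_iter_le j n n' : A j -> (n <= n')%N ->
  holonomy j (iter n phi [set j]) `<=` holonomy j (iter n' phi [set j]).
Proof.
move=> Aj; rewrite leq_eqVlt => /predU1P[-> //|nn'].
have [g gG ng] := iter_embed hphi pA nn' Aj Aj.
exact: holonomy_move_subset gG ng.
Qed.

(* By left invariance no conjugation appears here: the relative rotations of
   any two tiles of [x] literally occur in some [phi^n j]. *)
Lemma holonomy_tiling x j : subst_tilings A phi x -> A j ->
  holonomy j x = \bigcup_n holonomy j (iter n phi [set j]).
Proof.
move=> hx Aj; apply/seteqP; split; last first.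
  move=> q [n _]; have [g gG ng] := tiling_contains_iter hA hphi pA n hx Aj.
  exact: holonomy_move_subset gG ng _.
apply: holonomy_sub.
  apply: bigcup_subgroupSO => [n|n n']; first exact: holonomy_subgroup.
  exact: holonomy_iter_le.
move=> _ [r [s [[rS [t xr]] [sS [u xs]] ->]]].
pose P := [set move (r, t) j; move (s, u) j].
have fP : finite_set P by exact: finite_set2.
have [|n [g [_ gG gP]]] := finite_subpatch hphi pA 0 hx Aj fP.
  by move=> _ [->|->].
exists n => //; apply: holonomy_move_subset gG gP _ _.
apply: relative_poses_holonomy; exists r, s.
by split=> //; split=> //; [exists t; left|exists u; right].
Qed.

(** If [phi j] has a tile of type [k] in pose [s], a tile of type [j] in pose [r] yields one of type
    [k] in pose [r *m s]. Relative poses are thus conjugated by the inverse of [s], which does not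
    depend on [P]. *)
Lemma holonomy_subst j k : A j -> A k -> exists2 s, SO s &
  forall P, patch A P -> conjSO s (holonomy j P) `<=` holonomy k (phi P).
Proof.
move=> Aj Ak; have [b jb [[s v] sS bE]] := subst_types hphi Aj Ak.
rewrite /GE /= in sS; have VsS := SO_inv sS.
exists (invmx s) => // P pP.
have posesP r : poses j P r -> poses k (phi P) (r *m s).
  move=> [rS [t Pr]]; split; first exact: SO_mul.
  exists (r *m v + l *: t); rewrite (subst_union hphi)//; exists (move (r, t) j) => //.
  rewrite -move_patch1 (subst_equivariant hphi)//; last exact: pA.
  by exists b => //; rewrite bE move_comp.
suff : holonomy j P `<=` conjSO s (holonomy k (phi P)).
  move=> /(@conjSO_subset _ _ (invmx s)); rewrite conjSOM// mulVmx ?SO_unit//.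
  by rewrite conjSO1.
apply: holonomy_sub; first by apply: conjSO_subgroup => //; exact: holonomy_subgroup.
move=> _ [r [q [Pr Pq ->]]]; exists (invmx (r *m s) *m (q *m s)).
  apply: relative_poses_holonomy; exists (r *m s), (q *m s).
  by split=> //; exact: posesP.
have [rS _] := Pr; have su := SO_unit sS.
by rewrite invmx_SOM// !mulmxA mulmxV// mul1mx mulmxK.
Qed.

Lemma tiling_types x j : subst_tilings A phi x -> A j ->
  exists r t, SO r /\ x (move (r, t) j).
Proof.
(* At order 0 the supertile is the prototile itself. *)
move=> hx Aj; have [g gG gx] := tiling_contains_iter hA hphi pA 0 hx Aj.
by exists g.1, g.2; split=> //; apply: gx; exists j => //; case: (g).
Qed.

(** The conjugating rotation is composed of three: from [orient_group j x] to the holonomy of type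
    [j] by the inverse of [r], on to type [k] by [s], and into [orient_group k x'] by [r']. *)
Lemma orient_group_conj x x' j k : subst_tilings A phi x ->
  subst_tilings A phi x' -> A j -> A k ->
  conj_to_subgroup (orient_group j x) (orient_group k x').
Proof.
move=> hx hx' Aj Ak; have [s sS js] := holonomy_subst Aj Ak.
have [r [t [rS xr]]] := tiling_types hx Aj.
have [r' [t' [r'S xr']]] := tiling_types hx' Ak.
have VrS := SO_inv rS; have r'sS := SO_mul r'S sS; have qS := SO_mul r'sS VrS.
exists (r' *m s *m invmx r); split=> //.
exists (conjSO (r' *m s *m invmx r) (orient_group j x)); split=> //.
  by apply: conjSO_subgroup => //; apply: genSO_subgroup => ? [].
apply: subset_trans (conjSO_sub_orient_group r'S xr').
apply: subset_trans (conjSO_subset (orient_group_sub rS xr)) _.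
rewrite conjSOM// mulmxKV ?SO_unit// -conjSOM//; apply: conjSO_subset.
rewrite (holonomy_tiling hx Aj) => _ [q [n _ nq] <-].
(* The order is [n.+1] because passing from type [j] to type [k] costs one application of [phi]. *)
have [g gG gx] := tiling_contains_iter hA hphi pA n.+1 hx' Aj.
apply: (holonomy_move_subset gG gx); apply: js; last by exists q.
exact/(iter_patch hphi)/pA.
Qed.

End HolonomyOfTilings.

Theorem lemma2 (R : realType) (m : nat) (A : set (cell R m)) (l : R)
    (phi : set (cell R m) -> set (cell R m)) (hA : alphabet A)
    (hphi : substitution A l phi) (x x' : set (cell R m))
    (hx : subst_tilings A phi x) (hx' : subst_tilings A phi x')
    (j k : cell R m) (hj : A j) (hk : A k) :
  c_equivalent (orient_group j x) (orient_group k x').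
Proof.
have pA a : A a -> patch A [set a] by exact: (prototile_patch hphi hx).
by split; apply: (orient_group_conj hA hphi).
Qed.
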